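(* Let $H$ be a finite dimensional complex Hilbert space, $\lambda\in(0,1)$, and let $f_\lambda(x)=1-\lambda+\lambda x$. Then for any invertible $T\in\mathcal{B}(H)$ with polar decomposition $T=U|T|$, the limit $\lim_{n\to\infty}\Delta_{f_\lambda}^n(T)$ exists, and it does not depend on $\lambda$.
   Context: For an invertible $T$ with polar decomposition $T=U|T|$ ($U$ unitary, $|T|=(T^*T)^{1/2}$), the induced Aluthge transformation with respect to the $\lambda$-weighted arithmetic mean is $\Delta_{f_\lambda}(T)=(1-\lambda)|T|U+\lambda U|T|$ (which is again invertible). Iterates: $\Delta_{f_\lambda}^0(T)=T$, $\Delta_{f_\lambda}^n(T)=\Delta_{f_\lambda}(\Delta_{f_\lambda}^{n-1}(T))$. *)

(* Defs.v *)
From HB Require Import structures.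
From mathcomp Require Import all_boot all_order all_algebra.
From mathcomp Require Import complex ring.
From mathcomp Require Import all_classical all_reals all_analysis.
Set Implicit Arguments.
Unset Strict Implicit.
Unset Printing Implicit Defensive.
Import Order.TTheory GRing.Theory Num.Theory.
Import numFieldNormedType.Exports.
Local Open Scope classical_set_scope.
Local Open Scope complex_scope.
Local Open Scope ring_scope.

(* A finite dimensional complex Hilbert space is a [vectType R[i]] together   *)
(* with an inner product [dot], linear in its first argument, and B(H) is     *)
(* ['End(H)]. The adjoint, the positive square root and the unitary polar     *)
(* factor are selected by [xget], with default value 0: their existence is    *)
(* [adjointP], [absopP] and [polarP] below.                                   *)
Section Operators.
Variables (R : realType) (H : vectType R[i]) (dot : {dot H for Num.conj}).
Implicit Types (S T U P A : 'End(H)) (x y : H).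

Definition adjoint T : 'End(H) :=
  xget 0 [set S : 'End(H) | forall x y, dot (T x) y = dot x (S y)].

Definition unitary U :=
  (adjoint U \o U)%VF = \1%VF /\ (U \o adjoint U)%VF = \1%VF.

(* In R[i], [0 <= z] means that z is real and nonnegative; positivity         *)
(* therefore entails self-adjointness, see [positive_selfadjoint].            *)
Definition positive P := forall x, 0 <= dot (P x) x.

Definition psqrt A : 'End(H) :=
  xget 0 [set P : 'End(H) | positive P /\ (P \o P)%VF = A].

Definition absop T : 'End(H) := psqrt (adjoint T \o T)%VF.

Definition polar T : 'End(H) :=
  xget 0 [set U : 'End(H) | unitary U /\ T = (U \o absop T)%VF].

Definition invertible T :=
  exists S : 'End(H), (S \o T)%VF = \1%VF /\ (T \o S)%VF = \1%VF.

(* (1 - lam) |T| U + lam U |T|, the induced Aluthge transformation for        *)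
(* f_lam x = 1 - lam + lam * x.                                               *)
Definition aluthge (lam : R) T : 'End(H) :=
  (1 - lam)%:C *: (absop T \o polar T)%VF + lam%:C *: (polar T \o absop T)%VF.

Definition hnorm x : R := Num.sqrt (complex.Re (dot x x)).

Definition opnorm T : R := sup [set hnorm (T x) | x in [set x | hnorm x <= 1]].

Definition op_cvg (Ts : nat -> 'End(H)) (L : 'End(H)) :=
  opnorm (Ts n - L) @[n --> \oo] --> (0 : R).

Local Notation "M ^t*" := (map_mx Num.conj (trmx M)) (at level 30).
Local Notation C := R[i].
Import VectorInternalTheory.

Lemma dotZr (a : C) x y : dot x (a *: y) = Num.conj a * dot x y.
Proof. by rewrite linearZr_LR. Qed.

Lemma dotDr x y z : dot x (y + z) = dot x y + dot x z.
Proof. by rewrite linearDr. Qed.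

Lemma dotZl (a : C) x y : dot (a *: x) y = a * dot x y.
Proof. by rewrite linearZl_LR. Qed.

Lemma dotDl x y z : dot (x + y) z = dot x z + dot y z.
Proof. by rewrite linearDl. Qed.

Lemma dotC x y : dot x y = Num.conj (dot y x).
Proof. by rewrite [LHS]hermC /= expr0 mul1r. Qed.

Lemma dot_suml n (F : 'I_n -> H) y : dot (\sum_i F i) y = \sum_i dot (F i) y.
Proof. exact: linear_sumlz. Qed.

Lemma dot_sumr n (F : 'I_n -> H) x : dot x (\sum_i F i) = \sum_i dot x (F i).
Proof. exact: linear_sumr. Qed.

Lemma positive_selfadjoint P :
  positive P -> forall x y, dot (P x) y = dot x (P y).
Proof.
move=> Ppos x y.
have re z : Num.conj (dot (P z) z) = dot (P z) z by apply/CrealP/ger0_real/Ppos.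
pose a := dot (P x) y; pose c := dot (P y) x.
have h1 : Num.conj a + Num.conj c = a + c.
  have := re (x + y); rewrite !linearD /= !(dotDl, dotDr) !rmorphD /= !re.
  by rewrite -/a -/c => /eqP; rewrite -subr_eq0 => /eqP e; apply/eqP;
     rewrite -subr_eq0 -e; apply/eqP; ring.
have h2 : 'i * Num.conj a - 'i * Num.conj c = 'i * c - 'i * a.
  have Pxy : P (x + 'i *: y) = P x + 'i *: P y by rewrite linearD linearZ.
  move: (re (x + 'i *: y)); rewrite Pxy !(dotDl, dotDr, dotZl, dotZr).
  rewrite !(rmorphD, rmorphM) /= conjCK conjCi !re -/a -/c => /eqP.
  rewrite -subr_eq0 => /eqP e; apply/eqP.
  by rewrite -subr_eq0 -e; apply/eqP; ring.
have h3 : Num.conj a - Num.conj c = c - a.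
  by apply: (mulfI (neq0Ci C)); rewrite !mulrBr.
rewrite [RHS]dotC -/a -/c.
apply: (mulfI (_ : 2%:R != 0 :> C)); first by rewrite pnatr_eq0.
have -> : 2%:R * a = (a + c) - (c - a) by ring.
by rewrite -h1 -h3; ring.
Qed.

Lemma tcK m n (M : 'M[C]_(m, n)) : (M^t* )^t* = M.
Proof. by apply/matrixP => i j; rewrite !mxE conjCK. Qed.

Lemma tcM m n p (A : 'M[C]_(m, n)) (B : 'M[C]_(n, p)) :
  (A *m B)^t* = B^t* *m A^t*.
Proof. by rewrite trmx_mul map_mxM. Qed.

Lemma psd_sqrt n (G : 'M[C]_n) : G^t* = G ->
  (forall u : 'rV_n, 0 <= (u *m G *m u^t*) 0 0) ->
  exists B : 'M[C]_n, [/\ B^t* = B, B *m B = G &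
    forall u : 'rV_n, 0 <= (u *m B *m u^t*) 0 0].
Proof.
move=> Gh G0; pose P := spectralmx G; pose d := spectral_diag G.
have Pu : P \is unitarymx by exact: spectral_unitarymx.
have PP : P *m P^t* = 1%:M by apply/unitarymxP.
have PP' : P^t* *m P = 1%:M by apply: mulmx1C.
have GE : G = P^t* *m diag_mx d *m P.
  have /orthomx_spectralP : G \is normalmx by apply/normalmxP; rewrite Gh.
  by rewrite invmx_unitary.
have quad (e w : 'rV[C]_n) :
    (w *m diag_mx e *m w^t*) 0 0 = \sum_i e 0 i * (w 0 i * Num.conj (w 0 i)).
  rewrite mxE; apply: eq_bigr => i _; rewrite mul_mx_diag !mxE.
  by rewrite -mulrA mulrCA.
have d0 i : 0 <= d 0 i.
  have := G0 (delta_mx 0 i *m P); rewrite tcM GE.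
  rewrite -!mulmxA (mulmxA P (P^t*)) PP mul1mx (mulmxA P (P^t*)) PP mul1mx.
  rewrite mulmxA quad (bigD1 i) //= big1 => [|j ji]; last first.
    by rewrite !mxE (negPf ji) andbF mul0r mulr0.
  by rewrite !mxE !eqxx conjC1 !mulr1 addr0.
pose s := \row_i sqrtC (d 0 i).
exists (P^t* *m diag_mx s *m P); split.
- rewrite !tcM tcK mulmxA; congr (_ *m _ *m _).
  apply/matrixP => i j; rewrite !mxE; have [->|] := eqVneq j i.
    by rewrite mulr1n; apply/CrealP/ger0_real; rewrite sqrtC_ge0.
  by move=> _; rewrite !mulr0n conjC0.
- rewrite -!mulmxA (mulmxA P (P^t*)) PP mul1mx (mulmxA (diag_mx s)) mulmx_diag.
  rewrite [RHS]GE -mulmxA; congr (_ *m (diag_mx _ *m _)); apply/rowP => i.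
  by rewrite !mxE -expr2 sqrtCK.
- move=> u; have -> : u *m (P^t* *m diag_mx s *m P) *m u^t* =
      (u *m P^t*) *m diag_mx s *m (u *m P^t*)^t*.
    by rewrite tcM tcK !mulmxA.
  rewrite quad; apply: sumr_ge0 => i _.
  by rewrite mulr_ge0 ?mul_conjC_ge0 // mxE sqrtC_ge0.
Qed.

Lemma orthonormal_coord : exists n (f : {linear H -> 'rV[C]_n})
    (g : {linear 'rV[C]_n -> H}), [/\ cancel f g, cancel g f &
    forall x y, dot x y = (f x *m (f y)^t*) 0 0].
Proof.
exists (dim H).
pose v : {linear H -> 'rV[C]_(dim H)} := @v2r C H.
pose r : {linear 'rV[C]_(dim H) -> H} := @r2v C H.
have vK : cancel v r by exact: v2rK.
have rK : cancel r v by exact: r2vK.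
pose b i := r (delta_mx 0 i).
pose G : 'M[C]_(dim H) := \matrix_(i, j) dot (b i) (b j).
have vE x : x = \sum_i v x 0 i *: b i.
  rewrite -{1}(vK x) {1}[v x]row_sum_delta linear_sum.
  by apply: eq_bigr => i _; rewrite linearZ.
have dotG x y : dot x y = (v x *m G *m (v y)^t*) 0 0.
  rewrite {1}(vE x) {1}(vE y) dot_sumr mxE; apply: eq_bigr => j _.
  rewrite dotZr dot_suml !mxE mulrC; congr (_ * _).
  by apply: eq_bigr => i _; rewrite dotZl mxE.
have Gh : G^t* = G by apply/matrixP => i j; rewrite !mxE -dotC.
have G0 (u : 'rV_(dim H)) : 0 <= (u *m G *m u^t*) 0 0.
  by rewrite -(rK u) -dotG dnorm_ge0.
have [B [Bh BB _]] := psd_sqrt Gh G0.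
have Bu : B \in unitmx.
  rewrite -row_free_unit -kermx_eq0; apply/rowV0P => u /sub_kermxP uB.
  rewrite -(rK u); suff -> : r u = 0 by rewrite linear0.
  apply/eqP/negPn/negP => /(@neq0_dnorm_gt0 _ _ _ dot).
  by rewrite dotG rK -BB mulmxA uB !mul0mx mxE ltxx.
exists (mulmxr B \o v), (r \o mulmxr (invmx B)); split.
- by move=> x /=; rewrite mulmxK ?vK.
- by move=> u /=; rewrite rK mulmxKV.
- by move=> x y /=; rewrite dotG tcM Bh -BB !mulmxA.
Qed.

Lemma adjointP T x y : dot (T x) y = dot x (adjoint T y).
Proof.
suff : [set S : 'End(H) | forall x y, dot (T x) y = dot x (S y)] (adjoint T).
  exact.
have [n [f [g [fK gK fdot]]]] := orthonormal_coord.
pose M := lin1_mx (f \o T \o g).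
apply: (@xgetPex _ 0 _); exists (linfun (g \o mulmxr (M^t*) \o f)) => u v.
rewrite !fdot lfunE /= gK tcM tcK mulmxA.
by rewrite mul_rV_lin1 /= fK.
Qed.

Lemma dot_inj x y : (forall z, dot z x = dot z y) -> x = y.
Proof.
move=> e; apply/eqP; rewrite -subr_eq0; apply/negPn/negP => /(@neq0_dnorm_gt0 _ _ _ dot).
by rewrite [X in 0 < X]linearB /= e subrr ltxx.
Qed.

Lemma absopP T :
  positive (absop T) /\ (absop T \o absop T)%VF = (adjoint T \o T)%VF.
Proof.
apply: (@xgetPex _ 0 [set P : 'End(H) |
  positive P /\ (P \o P)%VF = (adjoint T \o T)%VF]).
have [n [f [g [fK gK fdot]]]] := orthonormal_coord.
pose N := lin1_mx (f \o (adjoint T \o T)%VF \o g).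
have fN x : f ((adjoint T \o T)%VF x) = f x *m N by rewrite mul_rV_lin1 /= fK.
have quad (u w : 'rV_n) : (u *m N *m w^t*) 0 0 = dot (T (g u)) (T (g w)).
  rewrite -[in LHS](gK u) -fN -[in LHS](gK w) -fdot comp_lfunE.
  by rewrite [LHS]dotC -adjointP -dotC.
have Nh : N^t* = N.
  apply/matrixP => i j.
  have E (A : 'M[C]_n) k l : A k l =
      ((delta_mx 0 k : 'rV_n) *m A *m (delta_mx 0 l : 'rV_n)^t*) 0 0.
    rewrite -rowE mxE (bigD1 l) //= big1 => [|m ml].
      by rewrite !mxE !eqxx conjC1 mulr1 addr0.
    by rewrite !mxE (negPf ml) andbF conjC0 mulr0.
  by rewrite 2!mxE [LHS](congr1 _ (E N j i)) [RHS](E N i j) !quad -dotC.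
have [|B [_ BB B0]] := psd_sqrt Nh; first by move=> u; rewrite quad dnorm_ge0.
exists (linfun (g \o mulmxr B \o f)); split=> [x|].
  by rewrite lfunE /= fdot gK.
apply/lfunP => x; rewrite comp_lfunE !lfunE /= gK -mulmxA BB -fN fK.
by rewrite comp_lfunE.
Qed.

Lemma polarP T :
  invertible T -> unitary (polar T) /\ T = (polar T \o absop T)%VF.
Proof.
move=> [S [ST TS]].
apply: (@xgetPex _ 0 [set U : 'End(H) | unitary U /\ T = (U \o absop T)%VF]).
have [Ppos PP] := absopP T; set P := absop T in Ppos PP *.
have Psa := positive_selfadjoint Ppos.
have Pdot x y : dot (P x) (P y) = dot (T x) (T y).
  by rewrite Psa adjointP -!comp_lfunE PP.
have P0 : lker P == 0%VS.
  apply/lker0P => x y e; have : dot (P (x - y)) (P (x - y)) = 0.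
    by rewrite linearB /= e subrr linear0.
  rewrite Pdot => d; have : T (x - y) = 0.
    apply/eqP/negPn/negP => /(@neq0_dnorm_gt0 _ _ _ dot); by rewrite d ltxx.
  move=> /(congr1 S); rewrite -comp_lfunE ST lfunE /= linear0.
  by move/eqP; rewrite subr_eq0 => /eqP.
exists (T \o P^-1)%VF; split; last by rewrite -comp_lfunA lker0_compVf // comp_lfun1r.
set U := (T \o P^-1)%VF.
have Udot x y : dot (U x) (U y) = dot x y.
  rewrite !comp_lfunE -Pdot -!(comp_lfunE P).
  by rewrite lker0_compfV // !lfunE.
have UU : (adjoint U \o U)%VF = \1%VF.
  apply/lfunP => x; apply: dot_inj => z.
  by rewrite comp_lfunE -adjointP Udot lfunE.
split => //.
have U0 : lker U == 0%VS.
  apply/lker0P => x y e; have := congr1 (adjoint U) e.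
  by rewrite -!comp_lfunE UU !lfunE.
have -> : adjoint U = (U^-1)%VF.
  by rewrite -[LHS]comp_lfun1r -(lker0_compfV U0) comp_lfunA UU comp_lfun1l.
exact: lker0_compfV.
Qed.

End Operators.

(* Main.v *)
(* Write T = U P with U unitary and P = |T|. Since P U = U^* T U, one step    *)
(* gives (1 - lam) U^* T U + lam T = U (lam P + (1 - lam) U^* P U), a unitary *)
(* times a positive operator. By uniqueness of the polar decomposition the    *)
(* unitary factor U is the same for all iterates, so the iteration is linear. *)
(* In an orthonormal eigenbasis of U, with U e_i = d_i e_i, it multiplies the *)
(* (i, j) entry by lam + (1 - lam) d_i conj(d_j), which is 1 if d_i = d_j and *)
(* has modulus < 1 otherwise: the limit keeps exactly the entries of T with   *)
(* d_i = d_j, whatever lam is.                                                *)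
Require Import Defs.
From mathcomp Require Import all_boot all_order all_algebra.
From mathcomp Require Import complex.
From mathcomp Require Import all_classical all_reals all_analysis.
From HB Require Import structures.
From mathcomp Require Import ring.
Set Implicit Arguments.
Unset Strict Implicit.
Unset Printing Implicit Defensive.
Import Order.TTheory GRing.Theory Num.Theory.
Import numFieldNormedType.Exports.
Local Open Scope ring_scope.

(** The unitary factor never changes, so in an orthonormal eigenbasis of it the transformation
    scales each entry separately, by 1 or by a factor of modulus below 1. [aluthge_step] gives the
    invariance, through [polar_uniq] and [positive_sqrt_uniq]; [normal_eigenbasis] supplies the
    eigenbasis; [normc_convex_lt1] bounds the factors; [op_cvg_entries] turns entrywise convergence
    into convergence in operator norm. *)

Lemma sum_sqr_le (K : numDomainType) m (s : 'I_m -> K) : (forall i, 0 <= s i) ->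
  \sum_i s i ^+ 2 <= (\sum_i s i) ^+ 2.
Proof.
move=> s0; rewrite expr2 mulr_suml; apply: ler_sum => i _.
rewrite expr2; apply: ler_wpM2l => //.
by rewrite (bigD1 i) //= lerDl sumr_ge0.
Qed.

Lemma normc_ge0 (R : rcfType) (z : R[i]) : 0 <= Normc.normc z.
Proof. by case: z => a b; exact: sqrtr_ge0. Qed.

(** * Orthonormal eigenbases, and the operator norm bounded through matrix entries *)

Section OrthonormalBasis.
Variables (R : realType) (H : vectType R[i]) (dot : {dot H for Num.conj}).
Implicit Types (A : 'End(H)) (x y : H).
Local Notation "M ^t*" := (map_mx Num.conj (trmx M)) (at level 30).
Local Notation C := R[i].

Definition orthonormal_basis n (e : 'I_n -> H) :=
  (forall i j, dot (e i) (e j) = (i == j)%:R) /\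
  (forall x, x = \sum_i dot x (e i) *: e i).

Lemma mx_quad_inj n (A B : 'M[C]_n) :
  (forall u w : 'rV_n, (u *m A *m w^t*) 0 0 = (u *m B *m w^t*) 0 0) -> A = B.
Proof.
have E (D : 'M[C]_n) k l : D k l =
    ((delta_mx 0 k : 'rV_n) *m D *m (delta_mx 0 l : 'rV_n)^t*) 0 0.
  rewrite -rowE mxE (bigD1 l) //= big1 => [|m ml].
    by rewrite !mxE !eqxx conjC1 mulr1 addr0.
  by rewrite !mxE (negPf ml) andbF conjC0 mulr0.
by move=> AB; apply/matrixP => i j; rewrite (E A) (E B) AB.
Qed.

(** In orthonormal coordinates the adjoint becomes the conjugate transpose, so the spectral theorem
    for normal matrices applies. Operators act on row vectors there, hence the eigenvectors are the
    rows of the unitary matrix [P]. *)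
Lemma normal_eigenbasis A :
  (adjoint dot A \o A)%VF = (A \o adjoint dot A)%VF ->
  exists n (e : 'I_n -> H) (d : 'I_n -> C),
    orthonormal_basis e /\ forall i, A (e i) = d i *: e i.
Proof.
move=> AA; have [n [f [g [fK gK fdot]]]] := orthonormal_coord dot.
pose mx (B : 'End(H)) := lin1_mx (f \o B \o g).
have fmx (B : 'End(H)) x : f (B x) = f x *m mx B by rewrite mul_rV_lin1 /= fK.
have mx_adj : mx (adjoint dot A) = (mx A)^t*.
  suff <- : (mx (adjoint dot A))^t* = mx A by rewrite tcK.
  apply: mx_quad_inj => u w.
  by rewrite -mulmxA -tcM -[u]gK -[w]gK -!fmx -!fdot adjointP.
have mxM (B1 B2 : 'End(H)) : mx (B1 \o B2)%VF = mx B2 *m mx B1.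
  apply/row_matrixP => i; rewrite !rowE -[delta_mx _ _]gK -fmx mulmxA -!fmx.
  by rewrite comp_lfunE.
have /orthomx_spectralP ME : mx A \is normalmx.
  by apply/normalmxP; rewrite -mx_adj -!mxM AA.
set P := spectralmx _ in ME; set d := spectral_diag _ in ME.
have Pu : P \is unitarymx by exact: spectral_unitarymx.
have PP : P *m P^t* = 1%:M by apply/unitarymxP.
have PP' : P^t* *m P = 1%:M by apply: mulmx1C.
have dotP x i : dot x (g (row i P)) = (f x *m P^t*) 0 i.
  by rewrite fdot gK !mxE; apply: eq_bigr => k _; rewrite !mxE.
exists n, (fun i => g (row i P)), (fun i => d 0 i); split; first split.
- by move=> i j; rewrite dotP gK -row_mul PP !mxE.
- move=> x; apply: (can_inj fK); rewrite linear_sum /=.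
  under eq_bigr do rewrite linearZ /= gK dotP.
  by rewrite -mulmx_sum_row -mulmxA PP' mulmx1.
- move=> i; apply: (can_inj fK); rewrite fmx linearZ /= gK.
  rewrite ME (invmx_unitary Pu) -row_mul !mulmxA PP mul1mx.
  by apply/rowP => j; rewrite mul_diag_mx !mxE.
Qed.

Lemma dot0l x : dot 0 x = 0.
Proof. by rewrite -(scale0r 0) dotZl mul0r. Qed.

Lemma dotNl x y : dot (- x) y = - dot x y.
Proof. by rewrite -scaleN1r dotZl mulN1r. Qed.

Lemma dotNr x y : dot x (- y) = - dot x y.
Proof. by rewrite -scaleN1r dotZr rmorphN1 mulN1r. Qed.

Section Basis.
Variables (n : nat) (e : 'I_n -> H).
Hypothesis eb : orthonormal_basis e.

Lemma basis_dot x y : dot x y = \sum_i dot x (e i) * Num.conj (dot y (e i)).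
Proof.
rewrite {1}(eb.2 y) dot_sumr; apply: eq_bigr => i _.
by rewrite dotZr mulrC.
Qed.

Lemma basis_lfunE A x : A x = \sum_i dot x (e i) *: A (e i).
Proof.
by rewrite {1}(eb.2 x) linear_sum; apply: eq_bigr => i _; rewrite linearZ.
Qed.

Lemma lfun_basis (w : 'I_n -> H) : exists A, forall i, A (e i) = w i.
Proof.
pose h x := \sum_i dot x (e i) *: w i.
have hlin : linear h.
  move=> a x y; rewrite /h scaler_sumr -big_split; apply: eq_bigr => i _ /=.
  by rewrite dotDl dotZl scalerDl scalerA.
pose hL : {linear H -> H} := HB.pack h (GRing.isLinear.Build _ _ _ _ h hlin).
exists (linfun hL) => i; rewrite lfunE /= /h (bigD1 i) //= big1 => [|j ji].
  by rewrite eb.1 eqxx scale1r addr0.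
by rewrite eb.1 eq_sym (negPf ji) scale0r.
Qed.

Lemma lfun_entries (M : 'I_n -> 'I_n -> C) :
  exists A, forall i j, dot (A (e i)) (e j) = M i j.
Proof.
have [A AE] := lfun_basis (fun i => \sum_j M i j *: e j).
exists A => i j; rewrite AE dot_suml (bigD1 j) //= big1 => [|k kj].
  by rewrite dotZl eb.1 eqxx mulr1 addr0.
by rewrite dotZl eb.1 (negPf kj) mulr0.
Qed.

(** The coordinates of [x] have modulus at most 1, so the [j]-th coordinate of [A x] is bounded by
    the [j]-th inner sum; [sum_sqr_le] then compares the sum of squares with the square of the
    sum. *)
Lemma dot_entries_le A x : dot x x <= 1 ->
  dot (A x) (A x) <= (\sum_j \sum_i `|dot (A (e i)) (e j)|) ^+ 2.
Proof.
move=> x1; have xi i : `|dot x (e i)| <= 1.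
  rewrite -(@ler_pXn2r _ 2) ?nnegrE // expr1n; apply: le_trans x1.
  rewrite [leRHS]basis_dot (bigD1 i) //= -normCK lerDl.
  by apply: sumr_ge0 => j _; exact: mul_conjC_ge0.
apply: (le_trans _ (sum_sqr_le _)) => [|j]; last exact: sumr_ge0.
rewrite basis_dot; apply: ler_sum => j _.
rewrite -normCK ler_pXn2r ?nnegrE ?sumr_ge0 //.
rewrite (basis_lfunE A x) dot_suml; apply: (le_trans (ler_norm_sum _ _ _)).
by apply: ler_sum => i _; rewrite dotZl normrM ler_piMl.
Qed.

Lemma hnorm_entries_le A x : hnorm dot x <= 1 ->
  hnorm dot (A x) <= \sum_j \sum_i Normc.normc (dot (A (e i)) (e j)).
Proof.
have dE y : (complex.Re (dot y y))%:C%C = dot y y.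
  by apply: RRe_real; apply: ger0_real; exact: dnorm_ge0.
have d0 y : 0 <= complex.Re (dot y y).
  by rewrite -ler0c dE; exact: dnorm_ge0.
rewrite /hnorm => x1; set s := \sum_j _.
have s0 : 0 <= s.
  by apply: sumr_ge0 => j _; apply: sumr_ge0 => i _; exact: normc_ge0.
rewrite -(ger0_norm s0) -sqrtr_sqr ler_wsqrtr // -lecR dE.
have -> : (s ^+ 2)%:C%C = (\sum_j \sum_i `|dot (A (e i)) (e j)|) ^+ 2.
  rewrite rmorphXn /= rmorph_sum /=; congr (_ ^+ 2).
  by apply: eq_bigr => j _; rewrite rmorph_sum.
apply: dot_entries_le; rewrite -dE -[1]/((1 : R)%:C)%C lecR.
by rewrite -(@ler_sqrt _ _ 1) // sqrtr1.
Qed.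

Lemma opnorm_entries_le A :
  0 <= opnorm dot A <= \sum_j \sum_i Normc.normc (dot (A (e i)) (e j)).
Proof.
set s := \sum_j _.
have h00 : hnorm dot 0 = 0 by rewrite /hnorm dot0l sqrtr0.
pose E := [set hnorm dot (A x) | x in [set x | hnorm dot x <= 1]]%classic.
have ub : ubound E s.
  by move=> _ [x x1 <-]; exact: hnorm_entries_le.
(* The value 0, attained at the zero vector, makes [E] nonempty and bounds its supremum from
   below. *)
have A0 : E 0 by exists 0; rewrite /= ?linear0 h00.
apply/andP; split; first by apply: ub_le_sup => //; exists s.
by apply: ge_sup => //; exists 0.
Qed.

End Basis.
End OrthonormalBasis.

(** * Uniqueness of the polar decomposition, and one step of the iteration *)

Section PolarUniqueness.
Variables (R : realType) (H : vectType R[i]) (dot : {dot H for Num.conj}).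
Implicit Types (A B P Q T U : 'End(H)) (x y : H).
Local Notation C := R[i].

Lemma adjoint_dot A x y : dot (adjoint dot A x) y = dot x (A y).
Proof. by rewrite dotC -adjointP -dotC. Qed.

Lemma adjoint_uniq A B :
  (forall x y, dot (A x) y = dot x (B y)) -> adjoint dot A = B.
Proof.
move=> AB; apply/lfunP => x; apply: (@dot_inj _ _ dot) => z.
by rewrite -adjointP AB.
Qed.

Lemma selfadjoint_eigenbasis A :
  (forall x y, dot (A x) y = dot x (A y)) ->
  exists n (e : 'I_n -> H) (d : 'I_n -> C),
    orthonormal_basis dot e /\ forall i, A (e i) = d i *: e i.
Proof.
by move=> Asa; apply: (@normal_eigenbasis _ _ dot); rewrite (adjoint_uniq Asa).
Qed.

(** In an eigenbasis of [P] the form is the sum of [d i] times the squared modulus of the [i]-th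
    coordinate of [x]. All terms are nonnegative, so each vanishes, and with it each coordinate of
    [P x]. *)
Lemma positive_dot_eq0 P x : positive dot P -> dot (P x) x = 0 -> P x = 0.
Proof.
move=> Ppos; have Psa := positive_selfadjoint Ppos.
have [n [e [d [eb Pe]]]] := selfadjoint_eigenbasis Psa.
have dE i : d i = dot (P (e i)) (e i) by rewrite Pe dotZl eb.1 eqxx mulr1.
have Pxe i : dot (P x) (e i) = d i * dot x (e i).
  by rewrite Psa Pe dotZr; congr (_ * _); apply/CrealP/ger0_real; rewrite dE.
rewrite (basis_dot eb) => /psumr_eq0P Px0.
rewrite (eb.2 (P x)) big1 // => i _; rewrite Pxe.
suff /eqP : d i * (dot x (e i) * Num.conj (dot x (e i))) = 0.
  rewrite mulf_eq0 mul_conjC_eq0 => /orP[] /eqP ->.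
    by rewrite mul0r scale0r.
  by rewrite mulr0 scale0r.
rewrite mulrA -Pxe; apply: Px0 => // j _.
by rewrite Pxe -mulrA mulr_ge0 ?mul_conjC_ge0 // dE.
Qed.

(* If (P - Q) e = d e with |e| = 1, then d = p - q for p = <P e, e> and        *)
(* q = <Q e, e>, while |P e| = |Q e| gives d (p + q) = 0; as p, q >= 0, d = 0. *)
Lemma positive_sqrt_uniq P Q : positive dot P -> positive dot Q ->
  (P \o P)%VF = (Q \o Q)%VF -> P = Q.
Proof.
move=> Ppos Qpos PQ.
have Psa := positive_selfadjoint Ppos; have Qsa := positive_selfadjoint Qpos.
have [x y|n [e [d [eb De]]]] := @selfadjoint_eigenbasis (P - Q).
  rewrite !add_lfunE !opp_lfunE dotDl dotDr Psa; congr (_ + _).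
  by rewrite dotNl dotNr Qsa.
apply/lfunP => x; rewrite (basis_lfunE eb P) (basis_lfunE eb Q).
apply: eq_bigr => i _; congr (_ *: _).
pose p := dot (P (e i)) (e i); pose q := dot (Q (e i)) (e i).
have Pe : P (e i) = Q (e i) + d i *: e i.
  by rewrite -De add_lfunE opp_lfunE addrC subrK.
have ee : dot (e i) (e i) = 1 by rewrite eb.1 eqxx.
have dE : d i = p - q by rewrite /p Pe dotDl dotZl ee mulr1 addrC addKr.
have d_real : Num.conj (d i) = d i.
  apply/CrealP; rewrite dE; apply: rpredB; apply: ger0_real.
    exact: Ppos.
  exact: Qpos.
have : dot (P (e i)) (P (e i)) = dot (Q (e i)) (Q (e i)).
  by rewrite Psa Qsa -!comp_lfunE PQ.
rewrite {1 2}Pe !(dotDl, dotDr, dotZl, dotZr) ee d_real -(Qsa (e i) (e i)) -/q.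
move=> /eqP; rewrite -subr_eq0 => /eqP h.
have : d i * (p + q) = 0.
  have -> : p = q + d i by rewrite dE addrC subrK.
  by rewrite -[RHS]h; ring.
move=> /eqP; rewrite mulf_eq0 => /orP[/eqP d0|].
  by rewrite Pe d0 scale0r addr0.
rewrite paddr_eq0 ?Ppos ?Qpos // => /andP[/eqP p0 /eqP q0].
by rewrite Pe dE p0 q0 subrr scale0r addr0.
Qed.

Lemma unitary_dot U x y : unitary dot U -> dot (U x) (U y) = dot x y.
Proof. by move=> [UU _]; rewrite adjointP -comp_lfunE UU lfunE. Qed.

(** The adjoint of [T] composed with [T] is the square of [P], so [absop dot T = P] by uniqueness of
    the positive root. Invertibility of [T] then lets [P] be cancelled on the right. *)
Lemma polar_uniq T U P : invertible T -> unitary dot U -> positive dot P ->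
  T = (U \o P)%VF -> polar dot T = U.
Proof.
move=> hT Uu Ppos TE; have [S [ST TS]] := hT.
have [Vu VE] := polarP dot hT; have [Apos AE] := absopP dot T.
have AP : absop dot T = P.
  apply: positive_sqrt_uniq => //; rewrite AE.
  apply/lfunP => x; apply: (@dot_inj _ _ dot) => z.
  rewrite comp_lfunE -adjointP TE !comp_lfunE unitary_dot //.
  exact: positive_selfadjoint.
(* Since [T S = U P S] is the identity, [P S] is the adjoint of [U]; thus [S U] is a right inverse
   of [P]. *)
have PSU : (P \o (S \o U))%VF = \1%VF.
  have USP : (U \o (P \o S))%VF = \1%VF by rewrite comp_lfunA -TE.
  rewrite comp_lfunA -Uu.1; congr (_ \o _)%VF.
  by rewrite -[RHS]comp_lfun1r -USP comp_lfunA Uu.1 comp_lfun1l.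
rewrite -[LHS]comp_lfun1r -PSU comp_lfunA -AP -VE comp_lfunA TS.
exact: comp_lfun1l.
Qed.

Lemma injective_invertible A : (forall x, A x = 0 -> x = 0) -> invertible A.
Proof.
move=> A0; have kA : lker A == 0%VS.
  apply/lker0P => x y e; apply/eqP; rewrite -subr_eq0; apply/eqP/A0.
  by rewrite linearB /= e subrr.
by exists (A^-1)%VF; rewrite lker0_compVf ?lker0_compfV.
Qed.

(** Invertibility is carried along so that the step can be iterated. It holds because [T' = U Q]
    with [Q] a positive combination of [P] and its conjugate [P']: if [Q x = 0], both nonnegative
    terms of [dot (Q x) x] vanish, so [P x = 0], then [T x = 0] and [x = 0]. *)
Lemma aluthge_step T (lam : R) : 0 < lam < 1 -> invertible T ->
  let U := polar dot T in let T' := aluthge dot lam T in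
  [/\ invertible T', polar dot T' = U &
    T' = lam%:C%C *: T + (1 - lam)%:C%C *: (adjoint dot U \o T \o U)%VF].
Proof.
move=> /andP[lam0 lam1] hT U T'.
have [Uu TE] := polarP dot hT; have [Ppos _] := absopP dot T.
rewrite -/U in Uu TE; set P := absop dot T in TE Ppos.
have l0 : 0 < lam%:C%C by rewrite ltcR.
have l1 : 0 < (1 - lam)%:C%C by rewrite ltcR subr_gt0.
pose P' : 'End(H) := (adjoint dot U \o P \o U)%VF.
have P'pos : positive dot P'.
  by move=> x; rewrite !comp_lfunE adjoint_dot.
pose Q := lam%:C%C *: P + (1 - lam)%:C%C *: P'.
have QE x : dot (Q x) x =
    lam%:C%C * dot (P x) x + (1 - lam)%:C%C * dot (P' x) x.
  by rewrite add_lfunE !scale_lfunE dotDl !dotZl.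
have Qpos : positive dot Q.
  by move=> x; rewrite QE addr_ge0 ?mulr_ge0 ?(ltW l0) ?(ltW l1) ?Ppos ?P'pos.
have T'E : T' = (U \o Q)%VF.
  rewrite /T' /aluthge -/U -/P /Q comp_lfunDr -!comp_lfunZr /P'.
  by rewrite !comp_lfunA Uu.2 comp_lfun1l addrC.
have hT' : invertible T'.
  apply: injective_invertible => x; rewrite T'E comp_lfunE => UQx.
  have Qx : Q x = 0.
    by rewrite -[Q x]id_lfunE -Uu.1 comp_lfunE UQx linear0.
  have : dot (Q x) x = 0 by rewrite Qx dot0l.
  rewrite QE => /eqP.
  rewrite paddr_eq0 ?mulr_ge0 ?(ltW l0) ?(ltW l1) ?Ppos ?P'pos //.
  rewrite mulf_eq0 gt_eqF //= => /andP[/eqP /(positive_dot_eq0 Ppos) Px _].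
  have [S [ST _]] := hT; rewrite -[x]id_lfunE -ST comp_lfunE TE comp_lfunE Px.
  by rewrite !linear0.
split => //; first exact: (polar_uniq hT' Uu Qpos).
rewrite /T' /aluthge -/U -/P addrC -TE; congr (_ + _ *: _).
by rewrite TE !comp_lfunA Uu.1 comp_lfun1l.
Qed.

End PolarUniqueness.

(** * Contraction of the entries and convergence of the iterates *)

Lemma normc_convex_lt1 (R : rcfType) (lam : R) (w : R[i]) : 0 < lam < 1 ->
  w * Num.conj w = 1 -> w != 1 ->
  Normc.normc (lam%:C%C + (1 - lam)%:C%C * w) < 1.
Proof.
move=> /andP[lam0 lam1] ww w1; set z := _ + _.
have rC (a : R) : Num.conj a%:C%C = a%:C%C.
  by apply/CrealP; apply/complex_realP; exists a.
have zz : `|z| ^+ 2 = 1 - lam%:C%C * (1 - lam)%:C%C * `|1 - w| ^+ 2.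
  have -> : (1 - lam)%:C%C = 1 - lam%:C%C by rewrite rmorphB rmorph1.
  rewrite !normCK /z !(rmorphB, rmorphD, rmorphM, rmorph1) /= !rC.
  apply/eqP; rewrite -subr_eq0; apply/eqP.
  (* The two sides of [zz] differ by exactly [1 - lam] times this vanishing quantity. *)
  have ww0 : w * Num.conj w - 1 = 0 by rewrite ww subrr.
  by rewrite -[RHS](mulr0 (1 - lam%:C%C)) -ww0; ring.
rewrite -ltcR -[(Normc.normc z)%:C%C]/(`|z|).
rewrite -(@ltr_pXn2r _ 2) ?nnegrE // expr1n zz ltrBlDr ltrDl.
apply: mulr_gt0; first by apply: mulr_gt0; rewrite ltcR ?subr_gt0.
by apply: exprn_gt0; rewrite normr_gt0 subr_eq0 eq_sym.
Qed.

Lemma op_cvg_entries (R : realType) (H : vectType R[i])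
    (dot : {dot H for Num.conj}) n (e : 'I_n -> H) (Ts : nat -> 'End(H)) L :
  orthonormal_basis dot e ->
  (forall i j, Normc.normc (dot ((Ts k - L) (e i)) (e j))
    @[k --> \oo] --> (0 : R))%classic ->
  op_cvg dot Ts L.
Proof.
move=> eb TL; rewrite /op_cvg.
pose s k := \sum_j \sum_i Normc.normc (dot ((Ts k - L) (e i)) (e j)).
apply: (@squeeze_cvgr _ _ _ _ (fun=> 0) s); [|exact: cvg_cst|].
  by apply: nearW => k; exact: opnorm_entries_le.
have -> : 0 = \sum_(j < n) \sum_(i < n) 0 :> R.
  by rewrite big1 // => j; rewrite big1.
apply: cvg_big => [|j _]; first exact: add_continuous.
by apply: cvg_big => [|i _]; [exact: add_continuous|exact: TL].
Qed.

Theorem theorem5p5 (R : realType) (H : vectType R[i])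
    (dot : {dot H for Num.conj}) (T : 'End(H)) (hT : invertible T) :
  exists L : 'End(H), forall lam : R, 0 < lam < 1 ->
    op_cvg dot (fun n => iter n (aluthge dot lam) T) L.
Proof.
pose U := polar dot T.
have [Uu _] := polarP dot hT; rewrite -/U in Uu.
have [n [e [d [eb Ue]]]] : exists n (e : 'I_n -> H) (d : 'I_n -> R[i]),
    orthonormal_basis dot e /\ forall i, U (e i) = d i *: e i.
  by apply: normal_eigenbasis; rewrite Uu.1 Uu.2.
have dd i : d i * Num.conj (d i) = 1.
  have := unitary_dot (e i) (e i) Uu.
  by rewrite Ue dotZl dotZr eb.1 eqxx mulr1.
(* [L] is built from [T] and the eigenbasis of [U] alone, before [lam] is introduced; this is the
   independence of [lam]. *)
have [L LE] := lfun_entries eb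
  (fun i j => if d i == d j then dot (T (e i)) (e j) else 0).
exists L => lam lam01; apply: (op_cvg_entries eb) => i j.
(* Moving the adjoint of [U] across [dot] and applying [U] to [e i] and [e j] produces the factor
   [d i * Num.conj (d j)]. *)
pose z := lam%:C%C + (1 - lam)%:C%C * (d i * Num.conj (d j)).
have TE k : [/\ invertible (iter k (aluthge dot lam) T),
    polar dot (iter k (aluthge dot lam) T) = U &
    dot (iter k (aluthge dot lam) T (e i)) (e j) =
      z ^+ k * dot (T (e i)) (e j)].
  elim: k => [|k [hTk pTk IH]]; first by rewrite expr0 mul1r.
  have [h p E] := aluthge_step dot lam01 hTk.
  split; rewrite ?iterS ?p // E pTk.
  rewrite add_lfunE !scale_lfunE !comp_lfunE dotDl !dotZl adjoint_dot !Ue.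
  move: IH; set Tk := iter k _ T => IH.
  by rewrite [Tk (_ *: _)]linearZ /= dotZl dotZr IH exprS /z; ring.
under eq_fun => k.
  have [_ _ Tk] := TE k.
  have -> : (iter k (aluthge dot lam) T - L) (e i) =
      iter k (aluthge dot lam) T (e i) - L (e i) by rewrite add_lfunE opp_lfunE.
  rewrite dotDl dotNl Tk LE; over.
(* If the eigenvalues agree, [z = 1] and the entry is constant; otherwise it decays geometrically to
   0. *)
have [dij|dij] := eqVneq (d i) (d j).
  have -> : z = 1 by rewrite /z dij dd mulr1 -rmorphD /= addrC subrK.
  under eq_fun do rewrite expr1n mul1r subrr Normc.normc0.
  exact: cvg_cst.
under eq_fun do rewrite subr0 Normc.normcM.
have normX k : Normc.normc (z ^+ k) = Normc.normc z ^+ k.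
  elim: k => [|k IH]; first by rewrite !expr0 Normc.normc1.
  by rewrite !exprS Normc.normcM IH.
under eq_fun do rewrite normX.
rewrite -(mul0r (Normc.normc (dot (T (e i)) (e j)))).
apply: cvgMl; apply: cvg_expr; rewrite ger0_norm ?normc_ge0 //.
apply: normc_convex_lt1 => //.
  by rewrite rmorphM /= conjCK mulrACA dd mul1r mulrC dd.
apply: contra dij => /eqP dij1; apply/eqP.
by rewrite -[LHS]mulr1 -(dd j) mulrCA dij1 mulr1.
Qed.
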